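(* Let $\mathbb{F}$ be a field of characteristic $>3$. Then $\mathfrak{sl}_3(\mathbb{F})$ has a COD if and only if $\mathbb{F}$ contains a primitive cube root of unity.
   Context: $\mathfrak{sl}_n(\mathbb{F})$ denotes the Lie algebra of $n\times n$ traceless matrices over $\mathbb{F}$. A Cartan subalgebra is a nilpotent self-normalizing subalgebra. A classical Cartan subalgebra of $\mathfrak{L}=\mathfrak{sl}_n(\mathbb{F})$ (with $\ell=\mathrm{char}\,\mathbb{F}$) is an abelian Cartan subalgebra $H$ such that: (a) $\mathfrak{L}=\bigoplus_\alpha \mathfrak{L}_\alpha$ with $\mathfrak{L}_\alpha=\{x: [x,h]=\alpha(h)x\ \forall h\in H\}$ over linear functionals $\alpha$ on $H$ (roots); (b) for each root $\alpha\ne0$, $[\mathfrak{L}_\alpha,\mathfrak{L}_{-\alpha}]$ is one-dimensional; (c) for roots $\alpha,\beta$ with $\beta\neq0$, not all $\alpha+k\beta$ ($1\le k\le \ell-1$) are roots. The Killing form is $K(A,B)=2n\,\mathrm{Tr}(AB)$. A COD of $\mathfrak{sl}_n(\mathbb{F})$ is a vector space decomposition $\mathfrak{sl}_n(\mathbb{F})=H_0\oplus\cdots\oplus H_n$ into classical Cartan subalgebras that are pairwise orthogonal with respect to $K$. *)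

(* Defs.v *)
From HB Require Import structures.
From mathcomp Require Import all_boot all_order all_algebra.
Set Implicit Arguments. Unset Strict Implicit. Unset Printing Implicit Defensive.
Import Order.TTheory GRing.Theory Num.Theory.
Local Open Scope ring_scope.

Section SlDefs.
Variables (F : fieldType) (n : nat).
Local Notation M := 'M[F]_n.

Definition in_sl (A : M) : Prop := \tr A = 0.

Definition lie (A B : M) : M := A *m B - B *m A.

Definition killing (A B : M) : F := (2 * n)%:R * \tr (A *m B).

Definition lie_subalgebra (H : {vspace M}) : Prop :=
  (forall A, A \in H -> in_sl A) /\
  (forall A B, A \in H -> B \in H -> lie A B \in H).

Definition lie_nilpotent (H : {vspace M}) : Prop :=
  exists k : nat, forall (xs : seq M) (y : M),
    size xs = k -> (forall x, x \in xs -> x \in H) -> y \in H ->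
    foldr lie y xs = 0.

Definition self_normalizing (H : {vspace M}) : Prop :=
  forall x, in_sl x -> (forall h, h \in H -> lie x h \in H) -> x \in H.

Definition cartan_subalgebra (H : {vspace M}) : Prop :=
  [/\ lie_subalgebra H, lie_nilpotent H & self_normalizing H].

Definition lie_abelian (H : {vspace M}) : Prop :=
  forall A B, A \in H -> B \in H -> lie A B = 0.

Definition functional (H : {vspace M}) := 'Hom(subvs_of H, F^o).

Definition root_space (H : {vspace M}) (alpha : functional H) (x : M) : Prop :=
  in_sl x /\ forall h : subvs_of H, lie x (vsval h) = (alpha h : F) *: x.

Definition is_root (H : {vspace M}) (alpha : functional H) : Prop :=
  exists x, x != 0 /\ root_space alpha x.

Definition root_decomposition (H : {vspace M}) : Prop :=
  (forall x, in_sl x -> exists (s : seq (functional H)) (f : functional H -> M),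
      uniq s /\ (forall a, a \in s -> root_space a (f a)) /\
      x = \sum_(a <- s) f a) /\
  (forall (s : seq (functional H)) (f : functional H -> M),
      uniq s -> (forall a, a \in s -> root_space a (f a)) ->
      \sum_(a <- s) f a = 0 -> forall a, a \in s -> f a = 0).

(* (b): [L_alpha, L_{-alpha}] (span of the brackets) is one-dimensional *)
Definition one_dim_bracket (H : {vspace M}) (alpha : functional H) : Prop :=
  (exists z : M, z != 0 /\
     forall x y, root_space alpha x -> root_space (- alpha) y ->
       exists c : F, lie x y = c *: z) /\
  (exists x y, root_space alpha x /\ root_space (- alpha) y /\ lie x y != 0).

(* Classical Cartan subalgebra, with l = char F. *)
Definition classical_cartan (l : nat) (H : {vspace M}) : Prop :=
  [/\ cartan_subalgebra H, lie_abelian H, root_decomposition H,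
      (forall alpha : functional H, is_root alpha -> alpha != 0 ->
          one_dim_bracket alpha) &
      (forall alpha beta : functional H, is_root alpha -> is_root beta ->
          beta != 0 ->
          exists k : nat, (1 <= k <= l.-1)%N /\ ~ is_root (alpha + beta *+ k))].

Definition has_COD (l : nat) : Prop :=
  exists H : 'I_n.+1 -> {vspace M},
    [/\ (forall i, classical_cartan l (H i)),
        (forall A, in_sl A -> A \in (\sum_i H i)%VS),
        directv (\sum_i H i)%VS &
        (forall i j, i != j -> forall A B, A \in H i -> B \in H j ->
           killing A B = 0)].

End SlDefs.

(* Main.v *)
Require Import Defs.
From HB Require Import structures.
From mathcomp Require Import all_boot all_order all_algebra ring.
Set Implicit Arguments. Unset Strict Implicit. Unset Printing Implicit Defensive.
Import GRing.Theory.
Local Open Scope ring_scope.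

(** Every classical Cartan subalgebra of sl_3 is conjugate over [F] to the traceless
    diagonal matrices: a nonzero eigenvalue of [ad h] already forces an eigenvalue of
    [h] in [F], and then diagonalizability of [ad h] gives that of [h].  Conjugate
    the first component of a COD to the diagonal.  Orthogonality makes every matrix [C]
    of the second component hollow, and makes the diagonal of [C^2] constant, so the
    products [C i j * C j i] all agree; choosing [C != 0] with [C 0 1 = 0]
    gives [tr C^2 = 0].  The eigenvalues [a, b, -a-b] of [C] lie in [F], so
    [a^2 + a b + b^2 = 0] and [a / b] is a primitive cube root of unity.
    Conversely, from such a root [w], the standard frame and the three frames with rows
    [(1, q w^k, q w^2k)], [q] in [{1, w, w^2}], are mutually unbiased, and the four
    subalgebras of matrices diagonal in these frames form a COD. *)

(** * Eigenvalues of [h] forced by eigenvectors of [ad h] *)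

Section AdEigenvalue.
Variables (F : fieldType).

Lemma char_poly_traceless3 (h : 'M[F]_3) : \tr h = 0 ->
  exists c0 c1 : F, char_poly h = 'X^3 + c1 *: 'X + c0%:P.
Proof.
move=> h0; exists (char_poly h)`_0, (char_poly h)`_1.
have c2 : (char_poly h)`_2 = 0 by rewrite (@char_poly_trace _ 3 h) // h0 oppr0.
have c3 : (char_poly h)`_3 = 1.
  by have /monicP := char_poly_monic h; rewrite lead_coefE size_char_poly.
apply/polyP => -[|[|[|[|i]]]]; rewrite !(coefD, coefXn, coefZ, coefX, coefC) /=.
- by rewrite mulr0 !add0r.
- by rewrite mulr1 add0r addr0.
- by rewrite c2 mulr0 !addr0.
- by rewrite c3 mulr0 !addr0.
by rewrite nth_default ?size_char_poly // mulr0 !addr0.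
Qed.

(** [eigenvalue] speaks of row vectors while [Y] consists of columns; the bridge is that a square
    [h - a] without left kernel is invertible and would kill [Y]. *)
Lemma eigenvalue_of_mulmx (n m : nat) (h : 'M[F]_n) (Y : 'M[F]_(n, m)) (a : F) :
  Y != 0 -> h *m Y = a *: Y -> eigenvalue h a.
Proof.
move=> Y0 hY; apply: contraNT Y0 => na.
have u : h - a%:M \in unitmx by rewrite -row_free_unit -kermx_eq0 -[_ == 0]negbK.
by rewrite -(mulKmx u Y) mulmxBl hY mul_scalar_mx subrr mulmx0.
Qed.

(** From [Y h = (h + c) Y], Cayley-Hamilton for [h] on either side of [Y] gives
    [chi(h) Y = chi(h + c) Y = 0]. The difference is a quadratic relation on [Y], and reducing [chi]
    modulo that quadratic leaves a linear one. *)
Lemma ad_eigenvector_eigenvalue3 (h Y : 'M[F]_3) (c : F) :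
  3%:R != 0 :> F -> \tr h = 0 -> Y != 0 -> c != 0 -> lie Y h = c *: Y ->
  exists a, eigenvalue h a.
Proof.
move=> n3 trh Y0 cn0 hY.
have [c0 [c1 chi]] := char_poly_traceless3 trh.
have CH : forall m (Z : 'M_(3, m)), h *m (h *m (h *m Z)) = - (c1 *: (h *m Z)) - c0 *: Z.
  move=> m Z; have := Cayley_Hamilton h.
  rewrite chi !rmorphD /= linearZ /= rmorphXn /= horner_mx_X horner_mx_C.
  move/(congr1 (fun A => A *m Z)); rewrite !mulmxDl mul0mx mul_scalar_mx -scalemxAl.
  rewrite -!mulmxA => e; apply/eqP; rewrite -subr_eq0 opprD !opprK addrA.
  by rewrite -e.
have CHr : Y *m h *m h *m h = - (c1 *: (Y *m h)) - c0 *: Y.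
  have := CH _ (1%:M : 'M_3); rewrite !mulmx1 => e.
  by rewrite -!mulmxA e mulmxBr mulmxN -!scalemxAr mulmx1.
have Yh : Y *m h = h *m Y + c *: Y by rewrite -hY /lie addrC subrK.
(* Constant term of [(chi(X + c) - chi(X)) / (3 c) = X^2 + c X + m]. *)
pose m := (c ^+ 2 + c1) / 3%:R.
have q : h *m (h *m Y) = - (c *: (h *m Y)) - m *: Y.
  have hYh : h *m Y *m h = h *m (h *m Y) + c *: (h *m Y).
    by rewrite -mulmxA Yh mulmxDr -scalemxAr.
  have hhYh : h *m (h *m Y) *m h = h *m (h *m (h *m Y)) + c *: (h *m (h *m Y)).
    by rewrite -mulmxA hYh mulmxDr -scalemxAr.
  move: CHr; do 3!rewrite ?(Yh, mulmxDl) -?scalemxAl ?hhYh ?hYh.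
  rewrite CH => /matrixP e; apply/matrixP => i j; move: (e i j); rewrite !mxE /m.
  move: (\sum_j0 h i j0 * (h *m Y) j0 j) (\sum_j0 h i j0 * Y j0 j) (Y i j) => y2 y1 y0 e'.
  have: (3%:R * c) * (y2 + (c * y1) + (c^+2 + c1) / 3%:R * y0) = 0.
    transitivity ((- (c1 * y1) - c0 * y0 + c * y2 + c * (y2 + c * y1) +
     c * (y2 + c * y1 + c * (y1 + c * y0))) - (- (c1 * (y1 + c * y0)) - c0 * y0)).
      by field.
    by rewrite e' subrr.
  move/eqP; rewrite mulf_eq0 mulf_eq0 (negPf n3) (negPf cn0) /= => /eqP H.
  by rewrite -[RHS]addr0 -H; ring.
(* The remainder of [chi] modulo [X^2 + c X + m] is [(c^2 - m + c1) X + (c m + c0)]. *)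
have lin : (c ^+ 2 - m + c1) *: (h *m Y) = - ((c * m + c0) *: Y).
  have := CH _ Y; rewrite q mulmxBr mulmxN -!scalemxAr q => /matrixP e.
  apply/matrixP => i j; move: (e i j); rewrite !mxE.
  move: (\sum_j0 h i j0 * Y j0 j) (Y i j) => y1 y0 e'.
  apply/eqP; rewrite -subr_eq0; apply/eqP.
  transitivity ((- (c * (- (c * y1) + - (m * y0))) + - (m * y1)) - (- (c1 * y1) + - (c0 * y0))).
    by ring.
  by rewrite e' subrr.
(* If the leading coefficient of the remainder vanishes, so does its constant term, and
   [chi = (X - c) (X^2 + c X + m)] has the root [c]. Otherwise [Y] itself consists of eigenvectors
   of [h]. *)
have [b0|b0] := eqVneq (c ^+ 2 - m + c1) 0.
  have c0E : c0 = - (c * m).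
    move: lin; rewrite b0 scale0r => /esym/eqP; rewrite oppr_eq0 scaler_eq0 (negPf Y0) orbF.
    by rewrite addrC addr_eq0 => /eqP.
  exists c; rewrite eigenvalue_root_char chi /root !hornerE c0E.
  by apply/eqP; transitivity (c * (c ^+ 2 - m + c1)); [ring | rewrite b0 mulr0].
exists (- ((c ^+ 2 - m + c1)^-1 * (c * m + c0))).
apply: (@eigenvalue_of_mulmx _ _ _ Y) => //.
by rewrite -[LHS](scalerK b0) lin scalerN scalerA scaleNr.
Qed.
End AdEigenvalue.

(** * Diagonalizability of [h] from that of [ad h] *)

Section AdDiagonalizable.
Variables (F : fieldType) (n : nat) (h : 'M[F]_n.+1).
Implicit Types (rs : seq F) (Z : 'M[F]_n.+1).

(** [D c] is [ad h - c], so [foldr D Z rs] applies to [Z] the polynomial in [ad h] with root list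
    [rs]. *)
Let D (c : F) Z := h *m Z - Z *m h - c *: Z.

Lemma ad_shifts_left_eigen rs (a : F) (v : 'rV_n.+1) (u : 'cV_n.+1) :
  v *m h = a *: v ->
  foldr D (u *m v) rs
    = horner_mx h (\prod_(c <- map (+%R a) rs) ('X - c%:P)) *m u *m v.
Proof.
move=> vh; elim: rs => [|c rs IH] /=.
  by rewrite big_nil rmorph1 mul1mx.
rewrite IH big_cons rmorphM /= rmorphB /= horner_mx_X horner_mx_C /D.
move: (horner_mx h _) => A.
rewrite -[X in _ - X - _]mulmxA vh -scalemxAr.
rewrite -[(h - _) * _ in RHS]/((h - (a + c)%:M) *m A) !mulmxBl mul_scalar_mx.
by rewrite -!scalemxAl scalerDl opprD addrA !mulmxA.
Qed.

Lemma ad_shifts_sum rs (I : Type) (t : seq I) (f : I -> 'M_n.+1) :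
  foldr D (\sum_(x <- t) f x) rs = \sum_(x <- t) foldr D (f x) rs.
Proof.
elim: rs => [//|c rs IH] /=.
by rewrite IH /D mulmx_sumr mulmx_suml scaler_sumr -!sumrB.
Qed.

Lemma ad_shifts_eigen rs (c : F) Z :
  h *m Z - Z *m h = c *: Z -> c \in rs -> foldr D Z rs = 0.
Proof.
move=> hZ; have -> : foldr D Z rs = (\prod_(x <- rs) (c - x)) *: Z.
  elim: rs => [|x rs IH] /=; first by rewrite big_nil scale1r.
  rewrite IH big_cons /D -scalemxAr -scalemxAl -scalerBr hZ !scalerA -scalerBl.
  by congr (_ *: _); ring.
by move=> crs; rewrite (big_rem c) //= subrr mul0r scale0r.
Qed.

(* If [v] is a left eigenvector of [h], then [ad h] acts on the matrices [u *m v]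
   as [h] shifted by a scalar acts on [u]. *)
Lemma diagonalizable_of_ad (a : F) : eigenvalue h a ->
  (forall Y, exists t : seq (F * 'M_n.+1),
     (forall x, x \in t -> h *m x.2 - x.2 *m h = x.1 *: x.2) /\
     Y = \sum_(x <- t) x.2) ->
  diagonalizable h.
Proof.
case/eigenvalueP=> v vh v0 dec.
have kill (i : 'I_n.+1) : exists rs, uniq rs /\
    horner_mx h (\prod_(c <- rs) ('X - c%:P)) *m delta_mx i (0 : 'I_1) = 0.
  have [t [tE ti]] := dec (delta_mx i 0 *m v).
  (* The eigenvalues of [ad h] that occur in the decomposition, shifted by [a]; dropping repetitions
     keeps the roots simple. *)
  exists (map (+%R a) (undup (map fst t))).
  split; first by rewrite map_inj_uniq ?undup_uniq //; apply: addrI.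
  set A := _ *m _.
  have Av : A *m v = 0.
    rewrite -ad_shifts_left_eigen // ti ad_shifts_sum big_seq big1 // => x xt.
    by apply: ad_shifts_eigen (tE _ xt) _; rewrite mem_undup map_f.
  have /rV0Pn[j vj] := v0; clearbody A.
  apply/matrixP=> k l; move/matrixP/(_ k j)/eqP: Av.
  by rewrite !mxE big_ord1 (ord1 l) mulf_eq0 (negPf vj) orbF => /eqP.
have [rs rsP] := fin_all_exists kill.
(* The product of the distinct linear factors needed for all basis columns annihilates [h], so the
   minimal polynomial of [h] divides it. *)
apply: (proj2 (diagonalizableP _)); exists (undup (flatten [seq rs i | i <- enum 'I_n.+1])).
  exact: undup_uniq.
apply: mxminpoly_min; set P := \prod_(_ <- _) _.
have Pi i : horner_mx h P *m delta_mx i (0 : 'I_1) = 0.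
  have [urs krs] := rsP i.
  have /dvdpP[Q ->] : \prod_(c <- rs i) ('X - c%:P) %| P.
    apply: uniq_roots_dvdp; last by rewrite uniq_rootsE.
    apply/allP=> c ci; rewrite root_prod_XsubC mem_undup.
    by apply/flattenP; exists (rs i) => //; apply: map_f; rewrite mem_enum.
  by rewrite rmorphM /= -mulmxA krs mulmx0.
apply/matrixP=> k i; move/matrixP/(_ k 0): (Pi i).
rewrite !mxE (bigD1 i) //= big1 ?addr0 => [|l /negPf li].
  by rewrite !mxE !eqxx mulr1.
by rewrite !mxE li mulr0.
Qed.
End AdDiagonalizable.

(** * Classical Cartan subalgebras of sl_3 are diagonalizable *)

(** For invertible [Q], the rows of [Q] are left eigenvectors of this matrix, with the entries of
    [v] as eigenvalues. *)
Definition conj_diag {F : fieldType} {n : nat} (Q : 'M[F]_n) (v : 'rV[F]_n) : 'M[F]_n :=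
  invmx Q *m diag_mx v *m Q.

Section Lie.
Variables (F : fieldType) (n : nat).
Implicit Types (A B C : 'M[F]_n).

Lemma lie_sumr (I : Type) (r : seq I) (f : I -> 'M[F]_n) A :
  lie A (\sum_(i <- r) f i) = \sum_(i <- r) lie A (f i).
Proof. by rewrite /lie mulmx_sumr mulmx_suml sumrB. Qed.

Lemma lie_suml (I : Type) (r : seq I) (f : I -> 'M[F]_n) A :
  lie (\sum_(i <- r) f i) A = \sum_(i <- r) lie (f i) A.
Proof. by rewrite /lie mulmx_sumr mulmx_suml sumrB. Qed.

Lemma lieZr c A B : lie A (c *: B) = c *: lie A B.
Proof. by rewrite /lie -scalemxAl -scalemxAr -scalerBr. Qed.

Lemma lieZl c A B : lie (c *: A) B = c *: lie A B.
Proof. by rewrite /lie -scalemxAl -scalemxAr -scalerBr. Qed.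

(** Comparing entries in the commutation with off-diagonal matrix units shows that [A] is scalar;
    its trace is then [n] times that scalar. *)
Lemma traceless_central_eq0 A : n%:R != 0 :> F -> \tr A = 0 ->
  (forall i j : 'I_n, i != j -> lie (delta_mx i j) A = 0) -> A = 0.
Proof.
move=> n0 trA cA.
have AE i j k l : i != j -> A k i *+ (l == j) = A j l *+ (k == i).
  move=> ij; have /matrixP/(_ k l) := cA i j ij; rewrite !mxE.
  rewrite (bigD1 j) //= big1 ?addr0 => [|m /negPf mj]; last by rewrite mxE mj andbF mul0r.
  rewrite (bigD1 i) //= big1 ?addr0 => [|m /negPf mi]; last by rewrite mxE mi /= mulr0.
  rewrite !mxE !eqxx andbT /= mulr_natl mulr_natr.
  by move/eqP; rewrite subr_eq0 => /eqP.
have off i j : i != j -> A i j = 0.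
  move=> ij; have := AE j i i i; rewrite eq_sym => /(_ ij).
  by rewrite eqxx (negPf ij) mulr1n mulr0n.
have dia i j : A i i = A j j.
  have [->//|ij] := eqVneq i j.
  by have := AE i j i j ij; rewrite !eqxx !mulr1n.
apply/matrixP=> i j; rewrite mxE; have [->|/off//] := eqVneq i j.
move/eqP: trA; rewrite /mxtrace (eq_bigr (fun _ => A j j)) // sumr_const card_ord.
by rewrite -mulr_natl mulf_eq0 (negPf n0) => /eqP.
Qed.
End Lie.

Section ClassicalCartanIsDiagonal.
Variables (F : fieldType) (l : nat) (H : {vspace 'M[F]_3}).
Hypothesis n3 : 3%:R != 0 :> F.
Hypothesis cartH : classical_cartan l H.

(** Some off-diagonal matrix unit does not commute with [h]; one of its root components then has a
    root that is nonzero at [h]. *)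
Lemma cartan_root_eigenvector (h : 'M_3) : h \in H -> h != 0 ->
  exists Y c, [/\ Y != 0, c != 0 & lie Y h = c *: Y].
Proof.
case: cartH => -[[slH _] _ _] _ [dec _] _ _ hH h0.
have [i [j [ij Eh]]] : exists i j : 'I_3, i != j /\ lie (delta_mx i j) h != 0.
  case: (boolP [forall i : 'I_3, forall j, (i != j) ==> (lie (delta_mx i j) h == 0)]).
    move=> /forallP c; case/eqP: h0; apply: traceless_central_eq0 => //.
      exact: slH.
    by move=> i j ij; have /forallP/(_ j) := c i; rewrite ij => /eqP.
  case/forallPn=> i /forallPn[j]; rewrite negb_imply => /andP[ij Eh].
  by exists i, j.
have [|s [f [_ [sf E]]]] := dec (delta_mx i j).
  by rewrite /in_sl /mxtrace big1 // => k _; rewrite mxE; case: eqVneq => // ->; rewrite (negPf ij).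
have lief a : a \in s -> lie (f a) h = (a (Subvs hH) : F) *: f a.
  by case/sf=> _ /(_ (Subvs hH)).
move: Eh; rewrite E lie_suml => /eqP Eh.
have /hasP[a ais af] : has (fun a => lie (f a) h != 0) s.
  apply/negPn/negP=> /hasPn z; apply: Eh.
  by rewrite big_seq big1 // => a /z; rewrite negbK => /eqP.
exists (f a), (a (Subvs hH) : F); move: af; rewrite lief // scaler_eq0 negb_or.
by case/andP.
Qed.

Lemma cartan_diagonalizable (h : 'M_3) : h \in H -> diagonalizable h.
Proof.
move=> hH; have [->|h0] := eqVneq h 0; first exact: diagonalizable0.
have [Y [c [Y0 c0 hY]]] := cartan_root_eigenvector hH h0.
case: cartH => -[[slH _] _ _] _ [dec _] _ _.
have [a ha] := ad_eigenvector_eigenvalue3 n3 (slH _ hH) Y0 c0 hY.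
(* The root decomposition covers only traceless matrices, so the scalar part [t] of [Z] is split
   off; it is an eigenvector of [ad h] for 0. *)
apply: diagonalizable_of_ad ha _ => Z; pose t := (\tr Z / 3%:R)%:M : 'M[F]_3.
have [|s [f [_ [sf E]]]] := dec (Z - t).
  by rewrite /in_sl raddfB /= mxtrace_scalar -[X in _ - X]mulr_natr divfK // subrr.
(* The sign appears because root spaces are defined by [[x, h]], whereas the criterion uses
   [[h, x]]. *)
exists ((0, t) :: [seq (- (b (Subvs hH) : F), f b) | b : functional H <- s]); split; last first.
  by rewrite big_cons big_map /= -E addrC subrK.
move=> x; rewrite inE => /orP[/eqP-> /=|/mapP[b /sf[_ /(_ (Subvs hH)) bE] ->] /=].
  by rewrite scalar_mxC subrr scale0r.
by rewrite -[LHS]opprB scaleNr -bE.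
Qed.

(** A basis of [H] consists of commuting diagonalizable matrices, hence is diagonal in one frame
    [Q]. Traceless matrices diagonal in that frame commute with [H], so self-normalization puts them
    in [H]. *)
Lemma cartan_conj_diag : exists2 Q : 'M_3, Q \in unitmx &
  forall v : 'rV_3, \sum_i v 0 i = 0 -> conj_diag Q v \in H.
Proof.
have [[[_ _] _ selfH] abH _ _ _] := cartH.
have : codiagonalizable (vbasis H : seq 'M[F]_3).
  apply: (proj1 (codiagonalizableP _)); split.
    move=> A B /vbasis_mem AH /vbasis_mem BH; apply/eqP.
    by rewrite -subr_eq0; apply/eqP/abH.
  by move=> A /vbasis_mem; apply: cartan_diagonalizable.
case=> Q uQ /allP dQ; exists Q => // v v0; apply: selfH.
  rewrite /in_sl /conj_diag mxtrace_mulC mulmxA mulmxV // mul1mx mxtrace_diag.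
  exact: v0.
move=> h hH; suff -> : lie (conj_diag Q v) h = 0 by apply: mem0v.
rewrite (coord_vbasis hH) lie_sumr big1 // => i _; rewrite lieZr.
have /dQ /= : (vbasis H)`_i \in (vbasis H : seq 'M[F]_3).
  by rewrite mem_nth // size_tuple.
move: (_`_i) => b /(diagonalizable_forLR uQ) [d].
rewrite mxpoly.conjVmx // => ->; rewrite /lie /conj_diag.
rewrite !mulmxA !mulmxK // -(mulmxA (invmx Q)) -[X in _ - X *m Q]mulmxA diag_mxC.
by rewrite subrr scaler0.
Qed.
End ClassicalCartanIsDiagonal.

(** * From a COD to a cube root of unity *)

Lemma sum3 (V : nmodType) (f : 'I_3 -> V) : \sum_i f i = f 0 + f 1 + f 2%:R.
Proof.
by rewrite !big_ord_recl big_ord0 addr0 addrA; congr (f _ + f _ + f _); apply: val_inj.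
Qed.

Lemma ord3P (P : 'I_3 -> Prop) : P 0 -> P 1 -> P 2%:R -> forall i, P i.
Proof.
move=> P0 P1 P2 [[|[|[|//]]] lti]; [apply: eq_ind P0 _ _|apply: eq_ind P1 _ _|apply: eq_ind P2 _ _];
by apply: val_inj.
Qed.

Section OrthogonalPair.
Variable (F : fieldType).
Hypotheses (n2 : 2%:R != 0 :> F) (n3 : 3%:R != 0 :> F).

(** The ratio [z] satisfies [z^2 + z + 1 = 0], so its order divides 3; [z = 1] would give
    [3 = 0]. *)
Lemma primitive_cube_root (a b : F) :
  b != 0 -> a ^+ 2 + a * b + b ^+ 2 = 0 -> 3.-primitive_root (a / b).
Proof.
move=> b0 ab; set z := a / b.
have z0 : z ^+ 2 + z + 1 = 0.
  transitivity ((a ^+ 2 + a * b + b ^+ 2) / b ^+ 2); last by rewrite ab mul0r.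
  by rewrite /z; field.
have z3 : z ^+ 3 = 1.
  by apply/eqP; rewrite -subr_eq0; apply/eqP; transitivity ((z - 1) * (z ^+ 2 + z + 1));
     [ring | rewrite z0 mulr0].
have [m mz m3] := @prim_order_exists _ 3 z isT z3.
have [_ /(_ m m3) /orP[]/eqP mE] := @primeP 3 isT; last by rewrite -mE.
have z1 : z = 1 by have := prim_expr_order mz; rewrite mE expr1.
by case/eqP: n3; rewrite -z0 z1; ring.
Qed.

Lemma conj_diagD n (Q : 'M[F]_n) u v : conj_diag Q (u + v) = conj_diag Q u + conj_diag Q v.
Proof. by rewrite /conj_diag raddfD /= mulmxDr mulmxDl. Qed.

Lemma conj_diagZ n (Q : 'M[F]_n) c v : conj_diag Q (c *: v) = c *: conj_diag Q v.
Proof. by rewrite /conj_diag linearZ /= -scalemxAr -scalemxAl. Qed.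

Lemma conj_diag_mul n (Q : 'M[F]_n) u v : Q \in unitmx ->
  conj_diag Q u *m conj_diag Q v = conj_diag Q (\row_i (u 0 i * v 0 i)).
Proof.
move=> uQ; rewrite /conj_diag -mulmx_diag !mulmxA mulmxK //.
Qed.

Lemma conj_diag_const n (Q : 'M[F]_n) c : Q \in unitmx -> conj_diag Q (const_mx c) = c%:M.
Proof. by move=> uQ; rewrite /conj_diag diag_const_mx mul_mx_scalar -scalemxAl mulVmx // scalemx1. Qed.

Lemma trace_conj_diag n (Q : 'M[F]_n) v : Q \in unitmx ->
  \tr (conj_diag Q v) = \sum_i v 0 i.
Proof. by move=> uQ; rewrite /conj_diag mxtrace_mulC mulKVmx // mxtrace_diag. Qed.

Lemma trace_diag_mul n (v : 'rV[F]_n) A : \tr (diag_mx v *m A) = \sum_i v 0 i * A i i.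
Proof. by apply: eq_bigr => i _; rewrite mul_diag_mx mxE. Qed.

(** Pairing with [v = e_i - e_0] reads off [A i i - A 0 0]. *)
Lemma diag_eq_of_trace0 (A : 'M[F]_3) :
  (forall v : 'rV_3, \sum_i v 0 i = 0 -> \tr (diag_mx v *m A) = 0) -> forall i, A i i = A 0 0.
Proof.
move=> orth i; have := orth (delta_mx 0 i - delta_mx 0 0).
rewrite trace_diag_mul (eq_bigr (fun j => (j == i)%:R - (j == 0)%:R)); last first.
  by move=> j _; rewrite !mxE /=.
have E (f : 'I_3 -> F) : \sum_j ((j == i)%:R - (j == 0)%:R) * f j = f i - f 0.
  have pick k : \sum_j (j == k)%:R * f j = f k.
    rewrite (bigD1 k) //= eqxx mul1r big1 ?addr0 // => j /negPf ->.
    by rewrite mul0r.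
  rewrite (eq_bigr (fun j => (j == i)%:R * f j - (j == 0)%:R * f j)).
    by rewrite sumrB !pick.
  by move=> j _; rewrite mulrBl.
have -> : \sum_(j < 3) ((j == i)%:R - (j == 0)%:R) = 0 :> F.
  rewrite -[RHS](subrr (1 : F)) -(E (fun=> 1)).
  by apply: eq_bigr => j _; rewrite mulr1.
move=> /(_ erefl).
rewrite (eq_bigr (fun j => ((j == i)%:R - (j == 0)%:R) * A j j)); last first.
  by move=> j _; rewrite !mxE /=.
by rewrite E => /eqP; rewrite subr_eq0 => /eqP.
Qed.

Lemma orthogonal_diag_pair_cube_root (S : 'M[F]_3) : S \in unitmx ->
  (forall v w : 'rV_3, \sum_i v 0 i = 0 -> \sum_i w 0 i = 0 ->
     \tr (diag_mx v *m conj_diag S w) = 0) ->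
  exists z : F, 3.-primitive_root z.
Proof.
move=> uS orth.
(* The diagonal is constant by orthogonality, and three times its value is the trace, which is
   zero. *)
have C0 (w : 'rV_3) : \sum_i w 0 i = 0 -> forall i, conj_diag S w i i = 0.
  move=> w0; have E i := @diag_eq_of_trace0 (conj_diag S w) (fun v v0 => orth v w v0 w0) i.
  have : \tr (conj_diag S w) = 0 by rewrite trace_conj_diag.
  rewrite /mxtrace (eq_bigr _ (fun i _ => E i)) sumr_const card_ord -mulr_natl => /eqP.
  by rewrite mulf_eq0 (negPf n3) => /eqP e i; rewrite E.
(* The square is again diagonal in the frame [S]. Subtracting the mean [t] of its eigenvalues makes
   it traceless, so that [orth] applies, and the scalar [t] contributes [t] times the sum of [v],
   which is 0. *)
have CC (w : 'rV_3) : \sum_i w 0 i = 0 -> forall i, (conj_diag S w *m conj_diag S w) i i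
                = (conj_diag S w *m conj_diag S w) 0 0.
  move=> w0; apply: diag_eq_of_trace0 => v v0.
  rewrite conj_diag_mul //; set u := \row_i _; set t := (\sum_i u 0 i) / 3%:R.
  have -> : u = (u - const_mx t) + const_mx t by rewrite subrK.
  rewrite conj_diagD mulmxDr raddfD /= orth //; last first.
    rewrite (eq_bigr (fun i => u 0 i - t)) => [|i _]; last by rewrite !mxE.
    by rewrite sumrB sumr_const card_ord -[X in _ - X]mulr_natr divfK // subrr.
  rewrite add0r conj_diag_const // mul_mx_scalar.
  by rewrite linearZ /= mxtrace_diag v0 mulr0.
(* One linear condition on a plane has a nonzero solution: unless [w1] already works, combine [w1]
   and [w2] so that their entries at [(0, 1)] cancel. *)
have [w [w0 wn0 w01]] : exists w : 'rV[F]_3,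
    [/\ \sum_i w 0 i = 0, w != 0 & conj_diag S w 0 1 = 0].
  pose w1 : 'rV[F]_3 := delta_mx 0 0 - delta_mx 0 1.
  pose w2 : 'rV[F]_3 := delta_mx 0 0 - delta_mx 0 2%:R.
  have s1 : \sum_i w1 0 i = 0 by rewrite sum3 !mxE /=; ring.
  have s2 : \sum_i w2 0 i = 0 by rewrite sum3 !mxE /=; ring.
  have [c|c] := eqVneq (conj_diag S w1 0 1) 0.
    exists w1; split => //; apply/rV0Pn; exists 0; rewrite !mxE /= subr0; exact: oner_neq0.
  exists (conj_diag S w1 0 1 *: w2 + - conj_diag S w2 0 1 *: w1); split.
  - rewrite (eq_bigr (fun i => conj_diag S w1 0 1 * w2 0 i + - conj_diag S w2 0 1 * w1 0 i)).
      by rewrite big_split /= -!mulr_sumr s1 s2 !mulr0 addr0.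
    by move=> i _; rewrite !mxE.
  - move: (conj_diag S w1 0 1) (conj_diag S w2 0 1) c => c1 c2 c.
    apply/rV0Pn; exists 2%:R; rewrite !mxE /= subrr mulr0 addr0 sub0r mulrN1.
    by rewrite oppr_eq0.
  - rewrite conj_diagD !conj_diagZ mxE [X in X + _]mxE [X in _ + X]mxE; ring.
(* For hollow [A] with [A 0 1 = 0], the diagonal of [A^2] is [A02 A20], [A12 A21],
   [A02 A20 + A12 A21]. Since the three entries agree, all vanish. *)
have tr0 : \sum_i w 0 i * w 0 i = 0.
  have := trace_conj_diag (\row_i (w 0 i * w 0 i)) uS.
  rewrite -conj_diag_mul // [in RHS](eq_bigr (fun i => w 0 i * w 0 i)); last first.
    by move=> i _; rewrite mxE.
  move=> <-; move: (C0 w w0) (CC w w0) w01; move: (conj_diag S w) => A A0 AA A01.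
  have := AA 1; have := AA 2%:R; rewrite /mxtrace sum3 !mxE !sum3 !A0 A01.
  rewrite !(mul0r, mulr0, add0r, addr0) => e1 e2.
  have z : A 2%:R 1 * A 1 2%:R = 0.
    by move: e1; rewrite [A 2%:R 0 * _]mulrC -[RHS]addr0 => /addrI.
  by rewrite e1 -e2 [A 1 _ * _]mulrC z !addr0.
have w2 : w 0 2%:R = - w 0 0 - w 0 1.
  by apply/eqP; rewrite -subr_eq0 -w0 sum3; apply/eqP; ring.
(* Eliminating the third eigenvalue turns the sum of squares into twice this form. *)
have q : w 0 0 ^+ 2 + w 0 0 * w 0 1 + w 0 1 ^+ 2 = 0.
  move: tr0; rewrite sum3 w2 => e; apply/eqP; rewrite -(mulrI_eq0 _ (mulfI n2)).
  by apply/eqP; rewrite -e; ring.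
exists (w 0 0 / w 0 1); apply: (primitive_cube_root _ q); apply: contraNneq wn0 => w1.
move: q; rewrite w1 mulr0 expr0n !addr0 => /eqP; rewrite sqrf_eq0 => /eqP w00.
by apply/eqP/rowP; apply: ord3P; rewrite mxE // w2 w00 w1 oppr0 addr0.
Qed.
End OrthogonalPair.

Section Forward.
Variables (F : fieldType) (l : nat).
Hypotheses (n2 : 2%:R != 0 :> F) (n3 : 3%:R != 0 :> F).

Lemma has_COD3_cube_root : has_COD F 3 l -> exists z : F, 3.-primitive_root z.
Proof.
case=> H [cH _ _ orth].
have [Q uQ QH] := cartan_conj_diag n3 (cH 0).
have [R uR RH] := cartan_conj_diag n3 (cH 1).
(* Conjugation by [Q] makes the first subalgebra diagonal, changes the second frame from [R] to
   [R *m invmx Q], and preserves traces; the factor 6 of the Killing form is invertible. *)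
apply: (@orthogonal_diag_pair_cube_root _ n2 n3 (R *m invmx Q)).
  by rewrite unitmx_mul uR unitmx_inv.
move=> v w v0 w0; have := orth 0 1 isT _ _ (QH v v0) (RH w w0).
move/eqP; rewrite /killing mulf_eq0 natrM mulf_eq0 (negPf n2) (negPf n3) /= => /eqP <-.
have -> : conj_diag (R *m invmx Q) w = Q *m conj_diag R w *m invmx Q.
  rewrite /conj_diag -[invmx (_ *m _)]/((R * Q^-1)^-1) invrM ?unitrV // invrK.
  by rewrite !mulmxA.
rewrite /conj_diag -!mulmxA [RHS]mxtrace_mulC.
by rewrite !mulmxA.
Qed.
End Forward.

(** * Diagonal subalgebras are classical Cartan subalgebras *)

(** Independence of eigenvectors for distinct characters: bracketing the relation with [h] and
    subtracting [b h] times it removes the term of [b]. Induction on the shorter relation forces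
    [a h = b h] for every [h] whenever [f a] is nonzero. *)
Lemma root_spaces_independent (F : fieldType) (n : nat) (H : {vspace 'M[F]_n})
    (s : seq (functional H)) (f : functional H -> 'M[F]_n) :
  uniq s -> (forall a, a \in s -> root_space a (f a)) ->
  \sum_(a <- s) f a = 0 -> forall a, a \in s -> f a = 0.
Proof.
elim: s f => [//|b s IH] f /= /andP[bs us] rf sum0.
have fs a : a \in s -> f a = 0.
  move=> ais; have ab : a != b by apply: contraNneq bs => <-.
  have rs (c : functional H) : c \in s -> root_space c (f c).
    by move=> cs; apply: rf; rewrite inE cs orbT.
  apply: contraNeq ab => fa0; apply/eqP/lfunP => h.
  pose g (c : functional H) := ((c h : F) - b h) *: f c.
  have rg (c : functional H) : c \in s -> root_space c (g c).
    move=> cs; have [slc cE] := rs c cs.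
    split=> [|k]; first by rewrite /in_sl linearZ /= slc mulr0.
    by rewrite lieZl cE /g !scalerA mulrC.
  have : g a = 0.
    apply: IH => //; have := congr1 (fun x => lie x (vsval h) - (b h : F) *: x) sum0.
    rewrite /lie mul0mx mulmx0 scaler0 !subrr -/(lie _ _) lie_suml scaler_sumr -sumrB.
    rewrite big_cons (proj2 (rf b _)) ?mem_head // subrr add0r => {2}<-.
    rewrite !big_seq; apply: eq_bigr => c cs.
    by rewrite (proj2 (rs c cs)) -scalerBl.
  by move/eqP; rewrite scaler_eq0 (negPf fa0) orbF subr_eq0 => /eqP.
move=> a; rewrite inE => /orP[/eqP->|/fs//].
by move: sum0; rewrite big_cons big_seq big1 ?addr0.
Qed.

Lemma mulrn_lfunE (R : nzRingType) (U V : vectType R) (f : 'Hom(U, V)) k x :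
  (f *+ k) x = f x *+ k.
Proof. by elim: k => [|k IH]; rewrite ?mulr0n ?lfunE // !mulrS add_lfunE IH. Qed.

Section DiagonalCartan.
Variables (F : fieldType) (n : nat) (Q : 'M[F]_n).
Hypotheses (uQ : Q \in unitmx).

(** [cj] preserves brackets and traces, so the computations are done for the standard diagonal and
    transported to the frame [Q]. *)
Let cj (X : 'M[F]_n) := invmx Q *m X *m Q.
Let uncj (x : 'M[F]_n) := Q *m x *m invmx Q.

Let uncjK x : cj (uncj x) = x.
Proof. by rewrite /cj /uncj !mulmxA mulVmx // mul1mx mulmxKV. Qed.

Let cjK X : uncj (cj X) = X.
Proof. by rewrite /cj /uncj !mulmxA mulmxV // mul1mx mulmxK. Qed.

Let tr_cj X : \tr (cj X) = \tr X.
Proof. by rewrite /cj mxtrace_mulC mulKVmx. Qed.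

Let lie_cj X Y : lie (cj X) (cj Y) = cj (lie X Y).
Proof.
by rewrite /lie /cj !mulmxA !mulmxK // -!(mulmxA (invmx Q)) -mulmxBr -mulmxBl !mulmxA.
Qed.

Let cjZ c X : cj (c *: X) = c *: cj X.
Proof. by rewrite /cj -scalemxAr -scalemxAl. Qed.

Let uncjZ c x : uncj (c *: x) = c *: uncj x.
Proof. by rewrite /uncj -scalemxAr -scalemxAl. Qed.

Let cj_sum (I : Type) (r : seq I) (f : I -> 'M_n) :
  cj (\sum_(i <- r) f i) = \sum_(i <- r) cj (f i).
Proof. by rewrite /cj mulmx_sumr mulmx_suml. Qed.

Let cj0 : cj 0 = 0. Proof. by rewrite /cj mulmx0 mul0mx. Qed.

Lemma lie_diag (X : 'M[F]_n) v i j : lie X (diag_mx v) i j = (v 0 j - v 0 i) * X i j.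
Proof. by rewrite /lie mul_mx_diag mul_diag_mx !mxE mulrC -mulrBl. Qed.

(** Written as the image of the kernel of the coordinate sum, so that rank-nullity bounds its
    dimension. *)
Definition diag_cartan : {vspace 'M[F]_n} :=
  (linfun (mulmxr Q \o mulmx (invmx Q) \o @diag_mx F n)
     @: lker (linfun (mulmxr (const_mx 1 : 'cV[F]_n) : 'rV[F]_n -> 'rV[F]_1)))%VS.

Lemma traceless_diagP (v : 'rV[F]_n) :
  reflect (\sum_i v 0 i = 0)
    (v \in lker (linfun (mulmxr (const_mx 1 : 'cV[F]_n) : 'rV[F]_n -> 'rV[F]_1))).
Proof.
have E : (v *m (const_mx 1 : 'cV[F]_n)) 0 0 = \sum_i v 0 i.
  by rewrite mxE; apply: eq_bigr => i _; rewrite mxE mulr1.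
rewrite memv_ker lfunE /= -E; apply: (iffP eqP) => [->|e]; first by rewrite mxE.
by apply/rowP => i; rewrite ord1 e mxE.
Qed.

Lemma diag_cartanP (x : 'M[F]_n) :
  reflect (exists2 v : 'rV_n, \sum_i v 0 i = 0 & x = conj_diag Q v) (x \in diag_cartan).
Proof.
apply: (iffP memv_imgP) => [[v /traceless_diagP v0 ->]|[v v0 ->]]; exists v => //.
- by rewrite lfunE.
- exact/traceless_diagP.
- by rewrite lfunE.
Qed.

Local Notation H := diag_cartan.

(** The difference is [j] minus [i] because [[E_ij, h] = (h_j - h_i) E_ij] for diagonal [h]. *)
Definition diag_root_fun (i j : 'I_n) (h : subvs_of H) : F^o :=
  uncj (vsval h) j j - uncj (vsval h) i i.

Fact diag_root_fun_linear i j : linear (diag_root_fun i j).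
Proof.
move=> c g h; rewrite /diag_root_fun /uncj [vsval (_ + _)]linearP /= mulmxDr mulmxDl.
by rewrite -scalemxAr -scalemxAl !mxE /GRing.scale /=; ring.
Qed.
HB.instance Definition _ i j :=
  GRing.isLinear.Build F (subvs_of H) F^o *:%R (diag_root_fun i j) (diag_root_fun_linear i j).

Definition diag_root (i j : 'I_n) : functional H := linfun (diag_root_fun i j).

Lemma diag_rootE i j (h : subvs_of H) v : vsval h = conj_diag Q v ->
  diag_root i j h = v 0 j - v 0 i :> F.
Proof.
move=> hv; rewrite /diag_root lfunE /= /diag_root_fun hv cjK.
by rewrite !mxE !eqxx.
Qed.

(** In the frame [Q], bracketing with a diagonal matrix scales each entry separately, so every
    nonzero entry determines the root. *)
Lemma diag_root_spaceP (a : functional H) x : root_space a x <->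
  in_sl x /\ forall i j, uncj x i j != 0 -> a = diag_root i j.
Proof.
split=> -[slx ax]; split=> //.
  move=> i j xij; apply/lfunP => h; have /diag_cartanP[v v0 hv] := subvsP h.
  rewrite (diag_rootE _ _ hv).
  have := ax h; rewrite hv -{1}(uncjK x) lie_cj => /(congr1 uncj); rewrite cjK => /matrixP/(_ i j).
  by rewrite lie_diag uncjZ [RHS]mxE => /(mulIf xij) <-.
move=> h; have /diag_cartanP[v v0 hv] := subvsP h.
rewrite hv -(uncjK x) lie_cj -cjZ; congr cj; apply/matrixP=> i j.
rewrite lie_diag [RHS]mxE; have [->|xij] := eqVneq (uncj x i j) 0; first by rewrite !mulr0.
by rewrite (ax i j xij) (diag_rootE _ _ hv).
Qed.

Let uncj_neq0 x : x != 0 -> exists i j, uncj x i j != 0.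
Proof.
by move=> x0; apply/matrix0Pn; apply: contraNneq x0 => e; rewrite -(uncjK x) e cj0.
Qed.

Lemma is_diag_root (a : functional H) : is_root a -> exists i j, a = diag_root i j.
Proof.
case=> x [/uncj_neq0[i [j xij]] /diag_root_spaceP[_ /(_ i j xij) ->]].
by exists i, j.
Qed.

Lemma diag_root_id i : diag_root i i = 0.
Proof.
apply/lfunP => h; have /diag_cartanP[v v0 hv] := subvsP h.
by rewrite (diag_rootE _ _ hv) subrr lfunE.
Qed.

Lemma diag_rootN i j : - diag_root i j = diag_root j i.
Proof.
apply/lfunP => h; have /diag_cartanP[v v0 hv] := subvsP h.
by rewrite opp_lfunE !(diag_rootE _ _ hv) opprB.
Qed.

Hypotheses (n0 : n%:R != 0 :> F) (n2 : 2%:R != 0 :> F) (n3 : 3%:R != 0 :> F).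

(** The vector [e_a] minus its mean: a sum-zero vector on which every root takes a value in -1, 0,
    1. *)
Let v_ (a : 'I_n) : 'rV[F]_n := \row_i ((i == a)%:R - n%:R^-1).

Let v_sum a : \sum_i v_ a 0 i = 0.
Proof.
rewrite (eq_bigr (fun i => (i == a)%:R - n%:R^-1)) => [|i _]; last by rewrite mxE.
rewrite sumrB sumr_const card_ord -[X in _ - X]mulr_natr mulVf //.
by rewrite (bigD1 a) //= eqxx big1 ?addr0 ?subrr // => i /negPf ->.
Qed.

Let v_H a : conj_diag Q (v_ a) \in H.
Proof. by apply/diag_cartanP; exists (v_ a). Qed.

Lemma diag_root_coweight i j a :
  diag_root i j (Subvs (v_H a)) = (j == a)%:R - (i == a)%:R :> F.
Proof. by rewrite (@diag_rootE _ _ _ (v_ a)) // !mxE opprB addrA subrK. Qed.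

(** At the coweights of [i] and [j] the left root is -1 and 1. As 2 is nonzero, these differ from
    the other values a root can take there. *)
Lemma diag_root_inj i j k l : i != j ->
  diag_root i j = diag_root k l -> k = i /\ l = j.
Proof.
move=> ij e; have E a : (j == a)%:R - (i == a)%:R = (l == a)%:R - (k == a)%:R :> F.
  by rewrite -!diag_root_coweight e.
split; apply/eqP.
  have /eqP := E i; rewrite eqxx [j == i]eq_sym (negPf ij) sub0r -subr_eq0.
  case: (k == i) => //; case: (l == i); rewrite ?subr0 ?subrr /= -?opprD oppr_eq0.
    by rewrite (negPf n2).
  by rewrite oner_eq0.
have /eqP := E j; rewrite eqxx (negPf ij) subr0 -subr_eq0.
case: (l == j) => //; case: (k == j); rewrite ?subr0 ?sub0r ?opprK /=.
  by rewrite (negPf n2).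
by rewrite oner_eq0.
Qed.

Lemma diag_root_space_offdiag i j x : i != j ->
  root_space (diag_root i j) x -> x = uncj x i j *: cj (delta_mx i j).
Proof.
move=> ij /diag_root_spaceP[_ rx]; rewrite -{1}(uncjK x) -cjZ; congr cj.
apply/matrixP=> k l; rewrite [RHS]mxE [delta_mx _ _ _ _]mxE.
have [xkl|/rx /(diag_root_inj ij)[-> ->]] := eqVneq (uncj x k l) 0; last first.
  by rewrite !eqxx mulr1.
rewrite xkl; case: eqP => [ki|]; last by rewrite mulr0.
by case: eqP => [lj|]; rewrite ?mulr0 // -ki -lj xkl mul0r.
Qed.

Lemma diag_root_space_delta i j : i != j -> root_space (diag_root i j) (cj (delta_mx i j)).
Proof.
move=> ij; apply/diag_root_spaceP; split.
  rewrite /in_sl tr_cj /mxtrace big1 // => k _; rewrite mxE.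
  by case: eqVneq => // ->; rewrite (negPf ij).
move=> k l; rewrite cjK mxE.
by have [->|ki] := eqVneq k i; have [->|lj] := eqVneq l j; rewrite //= eqxx.
Qed.

Lemma diag_cartan_subalgebra : cartan_subalgebra H /\ lie_abelian H.
Proof.
have ab : lie_abelian H.
  move=> _ _ /diag_cartanP[v v0 ->] /diag_cartanP[w w0 ->].
  by rewrite lie_cj /lie diag_mxC subrr cj0.
split=> //; split.
- split=> [_ /diag_cartanP[v v0 ->]|A B AH BH]; last by rewrite ab ?mem0v.
  by rewrite /in_sl tr_cj mxtrace_diag.
- exists 1%N => -[|x []] // y _ /(_ x (mem_head _ _)) xH yH; exact: ab.
move=> x slx nx; apply/diag_cartanP; exists (\row_i uncj x i i).
  rewrite (eq_bigr (fun i => uncj x i i)) => [|i _]; last by rewrite mxE.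
  by rewrite -[LHS]/(\tr (uncj x)) -tr_cj uncjK.
rewrite -{1}(uncjK x); congr cj; apply/matrixP=> i j; rewrite [RHS]mxE.
have [->|ij] := eqVneq i j; first by rewrite [_ 0 j]mxE.
(* Bracketing with [v_ j] multiplies the entry at [(i, j)] by 1, and the result is diagonal, so this
   entry vanishes. *)
rewrite mulr0n; have /diag_cartanP[w _] := nx _ (v_H j).
rewrite -{1}(uncjK x) lie_cj => /(congr1 uncj); rewrite !cjK => /matrixP/(_ i j).
rewrite lie_diag [RHS]mxE (negPf ij) !mxE eqxx (negPf ij) mulr0n.
by rewrite opprB addrA subrK subr0 mul1r.
Qed.

Lemma diag_cartan_root_decomposition : root_decomposition H.
Proof.
split=> [x slx|]; last exact: root_spaces_independent.
(* The component at [a] collects the entries of [x], in the frame [Q], at all positions with root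
   [a]; the diagonal positions share the root 0. *)
pose f (a : functional H) := cj (\matrix_(i, j) (uncj x i j *+ (diag_root i j == a))).
exists (undup [seq diag_root ij.1 ij.2 | ij <- enum {: 'I_n * 'I_n}]), f.
split; first exact: undup_uniq.
split=> [a _|].
  apply/diag_root_spaceP; split.
    rewrite /in_sl tr_cj; rewrite /mxtrace.
    rewrite (eq_bigr (fun i => uncj x i i *+ (0 == a))) => [|i _].
      by rewrite sumrMnl -[X in X *+ _]/(\tr (uncj x)) -tr_cj uncjK slx mul0rn.
    by rewrite mxE diag_root_id.
  move=> i j; rewrite cjK mxE; have [->//|_] := eqVneq (diag_root i j) a.
  by rewrite mulr0n eqxx.
rewrite -cj_sum -{1}(uncjK x); congr cj; apply/matrixP=> i j; rewrite summxE.
rewrite (bigD1_seq (diag_root i j)) /= ?undup_uniq //; last first.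
  by rewrite mem_undup (map_f (fun ij => diag_root ij.1 ij.2) (mem_enum _ (i, j))).
rewrite [X in _ = X + _]mxE eqxx big1 ?addr0 // => a /negPf aij.
by rewrite mxE eq_sym aij.
Qed.

(** Both root spaces are lines, spanned by the conjugates of [E_ij] and [E_ji], whose bracket is the
    conjugate of [E_ii - E_jj]. *)
Lemma diag_cartan_one_dim_bracket (a : functional H) :
  is_root a -> a != 0 -> one_dim_bracket a.
Proof.
case/is_diag_root=> i [j ->] a0.
have ij : i != j by apply: contraNneq a0 => ->; rewrite diag_root_id.
have bracket : lie (cj (delta_mx i j)) (cj (delta_mx j i)) = cj (delta_mx i i - delta_mx j j).
  by rewrite lie_cj /lie !mul_delta_mx.
have bracket0 : cj (delta_mx i i - delta_mx j j) != 0.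
  apply/eqP => /(congr1 uncj); rewrite cjK /uncj mulmx0 mul0mx => /matrixP/(_ i i).
  by rewrite !mxE !eqxx (negPf ij) subr0 => /eqP; rewrite oner_eq0.
rewrite /one_dim_bracket diag_rootN; split.
  exists (cj (delta_mx i i - delta_mx j j)); split => // x y rx ry.
  have ji : j != i by rewrite eq_sym.
  rewrite (diag_root_space_offdiag ij rx) (diag_root_space_offdiag ji ry).
  by rewrite lieZl lieZr bracket scalerA; exists (uncj x i j * uncj y j i).
exists (cj (delta_mx i j)), (cj (delta_mx j i)); rewrite bracket.
by split; [|split] => //; apply: diag_root_space_delta; rewrite // eq_sym.
Qed.

(** At the coweight of [j'] the root [b] is 1 and [a] is -1, 0 or 1, so some [k] from 1 to 3 brings
    [a + k b] to 2. A root takes only the values -1, 0, 1 there, and 2 equals none of them because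
    1, 2 and 3 are nonzero in [F]. *)
Lemma diag_cartan_root_string (l : nat) (a b : functional H) : (3 < l)%N ->
  is_root a -> is_root b -> b != 0 ->
  exists k : nat, (1 <= k <= l.-1)%N /\ ~ is_root (a + b *+ k).
Proof.
move=> l3 /is_diag_root[i [j ->]] /is_diag_root[i' [j' ->]] b0.
have ij : i' != j' by apply: contraNneq b0 => ->; rewrite diag_root_id.
suff [k [k3 kE]] : exists k : nat, (1 <= k <= 3)%N /\
    (j == j')%:R - (i == j')%:R + k%:R = 2%:R :> F.
  exists k; split; first by case/andP: k3 => -> /leq_trans; apply; case: l l3.
  case/is_diag_root=> u [w /lfunP/(_ (Subvs (v_H j')))].
  rewrite add_lfunE mulrn_lfunE !diag_root_coweight eqxx (negPf ij) subr0.
  rewrite kE; case: (w == _); case: (u == _) => /eqP; rewrite ?subrr ?subr0 ?sub0r.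
  - by rewrite (negPf n2).
  - by rewrite -subr_eq0 -[2%:R]/(1+1) addrK oner_eq0.
  - by rewrite -subr_eq0 opprK -[_ + 1](natrD _ 2 1) (negPf n3).
  - by rewrite (negPf n2).
case: (j == _); case: (i == _).
- by exists 2%N; rewrite subrr add0r.
- by exists 1%N; rewrite subr0.
- by exists 3%N; rewrite sub0r addrC -[3%N]/(2 + 1)%N natrD addrK.
- by exists 2%N; rewrite subrr add0r.
Qed.

Lemma diag_cartan_classical (l : nat) : (3 < l)%N -> classical_cartan l H.
Proof.
move=> l3; have [cH aH] := diag_cartan_subalgebra.
split=> //.
- exact: diag_cartan_root_decomposition.
- exact: diag_cartan_one_dim_bracket.
- by move=> a b; apply: diag_cartan_root_string.
Qed.
End DiagonalCartan.

(** * Mutually unbiased frames *)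

Section Decomposition.
Variables (F : fieldType) (n : nat).

Lemma diag_cartan_sl (Q A : 'M[F]_n) : Q \in unitmx -> A \in diag_cartan Q -> \tr A = 0.
Proof. by move=> uQ /diag_cartanP[v v0 ->]; rewrite trace_conj_diag. Qed.

Lemma dim_diag_cartan (Q : 'M[F]_n) : Q \in unitmx -> (n.-1 <= \dim (diag_cartan Q))%N.
Proof.
move=> uQ; rewrite /diag_cartan; set S := linfun (mulmxr _); set f := linfun (_ \o _).
rewrite limg_dim_eq; last first.
  have /eqP-> : lker f == 0%VS; last by rewrite capv0.
  apply/lker0P => v w; rewrite !lfunE /= => e.
  have /matrixP d : diag_mx v = diag_mx w.
    move/(congr1 (fun A => Q *m A *m invmx Q)): e.
    by rewrite /= -!mulmxA !mulKVmx // mulmxV // !mulmx1.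
  by apply/rowP => i; have := d i i; rewrite !mxE !eqxx.
have := limg_ker_dim S fullv; rewrite capfv dimvf dim_matrix mul1r => dimS.
have : (\dim (limg S) <= 1)%N by apply: leq_trans (dimvS (subvf _)) _; rewrite dimvf dim_matrix.
by rewrite -[X in (X.-1 <= _)%N]dimS; case: (\dim (limg S)) => [|[|]]; rewrite ?addn0 ?addn1 ?leq_pred.
Qed.

(** The trace form is nondegenerate on each subalgebra, so pairwise orthogonality makes the sum
    direct; a dimension count then shows that it fills the traceless matrices. *)
Lemma has_COD_of_orthogonal_frames (l : nat) (Q : 'I_n.+1 -> 'M[F]_n) :
  (3 < l)%N -> n%:R != 0 :> F -> 2%:R != 0 :> F -> 3%:R != 0 :> F ->
  (forall i, Q i \in unitmx) ->
  (forall i j (v w : 'rV_n), i != j -> \sum_k v 0 k = 0 -> \sum_k w 0 k = 0 ->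
     \tr (conj_diag (Q i) v *m conj_diag (Q j) w) = 0) ->
  has_COD F n l.
Proof.
move=> l3 n0 n2 n3 uQ orth; pose H i := diag_cartan (Q i).
have dH : directv (\sum_i H i)%VS.
  apply/directv_sum_independent => us usH us0 i _.
  have /diag_cartanP[v v0 uE] := usH i isT.
  suff : v = 0 by rewrite uE => ->; rewrite /conj_diag linear0 mulmx0 mul0mx.
  apply/rowP => a; rewrite mxE.
  (* Pairing the sum-zero [v] with the centred [e_a] returns the coordinate [v 0 a]. *)
  pose w : 'rV[F]_n := \row_k ((k == a)%:R - n%:R^-1).
  have pick (f : 'I_n -> F) : \sum_k f k * (k == a)%:R = f a.
    rewrite (bigD1 a) //= eqxx mulr1 big1 ?addr0 // => k /negPf ->.
    by rewrite mulr0.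
  have w0 : \sum_k w 0 k = 0.
    rewrite (eq_bigr (fun k => 1 * (k == a)%:R - n%:R^-1)) => [|k _]; last first.
      by rewrite mxE mul1r.
    by rewrite sumrB (pick (fun=> 1)) sumr_const card_ord -[X in _ - X]mulr_natr mulVf ?subrr.
  have : \tr (us i *m conj_diag (Q i) w) = 0.
    have := congr1 (fun A => \tr (A *m conj_diag (Q i) w)) us0.
    rewrite /= mul0mx linear0 mulmx_suml raddf_sum (bigD1 i) //= big1 ?addr0 // => j ji.
    have /diag_cartanP[u u0 ->] := usH j isT; exact: orth.
  rewrite uE conj_diag_mul // trace_conj_diag //.
  rewrite (eq_bigr (fun k => v 0 k * (k == a)%:R - v 0 k * n%:R^-1)) => [|k _]; last first.
    by rewrite !mxE mulrBr.
  by rewrite sumrB pick -mulr_suml v0 mul0r subr0.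
exists H; split=> //.
- by move=> i; apply: diag_cartan_classical.
- pose tr := linfun (mxtrace : 'M[F]_n -> F^o).
  have sub : (\sum_i H i <= lker tr)%VS.
    apply/subv_sumP => i _; apply/subvP => A AH.
    by rewrite memv_ker lfunE /= (diag_cartan_sl (uQ i)).
  suff /eqP -> : (\sum_i H i == lker tr)%VS.
    by move=> A A0; rewrite memv_ker lfunE /= A0.
  (* The sum has dimension at least [(n + 1) (n - 1) = n^2 - 1], while the kernel of the trace is
     proper because the identity has trace [n != 0]. *)
  rewrite eqEdim sub (directvP dH) /=.
  apply: (@leq_trans (n.+1 * n.-1)%N); last first.
    by rewrite -[X in (X * _ <= _)%N]card_ord -sum_nat_const leq_sum // => i _; exact: dim_diag_cartan.
  have := limg_ker_dim tr fullv; rewrite capfv dimvf dim_matrix -[(n * n)%R]/(n * n)%N.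
  have : (0 < \dim (limg tr))%N.
    rewrite lt0n dimv_eq0; apply: contraNneq n0 => e.
    have := memv_img tr (memvf (1%:M : 'M[F]_n)); rewrite e memv0 lfunE /=.
    by rewrite mxtrace1.
  case: (\dim (limg tr)) => // d _ dE.
  have n_gt0 : (0 < n)%N by rewrite lt0n; apply: contraNneq n0 => ->.
  have : (\dim (lker tr) < n * n)%N by rewrite -dE addnS ltnS leq_addr.
  move/leq_trans=> lt; rewrite -ltnS; apply: lt; case: (n) n_gt0 => // m _.
  by rewrite (mulSn m m.+1) mulnS !mulSn addSn.
- move=> i j ij A B /diag_cartanP[v v0 ->] /diag_cartanP[w w0 ->].
  by rewrite /killing orth ?mulr0.
Qed.

(* The hypothesis says that the frames given by the rows of [Q] and [R] are
   mutually unbiased. *)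
Lemma unbiased_frames_orthogonal (Q R : 'M[F]_n) (c : F) (v w : 'rV[F]_n) :
  (forall k m, (Q *m invmx R) k m * (R *m invmx Q) m k = c) ->
  \sum_k v 0 k = 0 -> \sum_k w 0 k = 0 ->
  \tr (conj_diag Q v *m conj_diag R w) = 0.
Proof.
set U := Q *m _; set V := R *m _ => unb v0 w0.
transitivity (\tr (diag_mx v *m (U *m diag_mx w *m V))).
  by rewrite /conj_diag -!mulmxA mxtrace_mulC -!mulmxA.
(* Entrywise, the trace is the double sum of [v_k U_km w_m V_mk], hence [c] times the product of the
   sums of [v] and [w]. *)
rewrite trace_diag_mul (eq_bigr (fun k => v 0 k * \sum_m (c * w 0 m))) => [|k _].
  by rewrite -mulr_suml v0 mul0r.
congr (_ * _); rewrite mxE; apply: eq_bigr => m _.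
by rewrite mul_mx_diag mxE mulrAC unb.
Qed.
End Decomposition.

(** * Unbiased frames built from a cube root of unity *)

Section CubeRoot.
Variables (F : fieldType) (w : F).
Hypotheses (prim : 3.-primitive_root w) (n3 : 3%:R != 0 :> F).

Let w3 : w ^+ 3 = 1 := prim_expr_order prim.
Let x (k : nat) : F := w ^+ k.
Let x3 k : x k ^+ 3 = 1. Proof. by rewrite /x -exprM mulnC exprM w3 expr1n. Qed.

Let ratio3 (k m : nat) : (x k * x m ^+ 2) ^+ 3 = 1.
Proof.
by transitivity (x k ^+ 3 * (x m ^+ 3) ^+ 2); [ring | rewrite !x3 expr1n mulr1].
Qed.

(** Orthogonality of the characters of [Z/3]; [x k * x m ^+ 2] is [w^(k - m)] without inverses,
    since [x m ^+ 3 = 1]. *)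
Let ratio (k m : nat) : 1 + x k * x m ^+ 2 + (x k * x m ^+ 2) ^+ 2
  = 3%:R *+ (k == m %[mod 3]).
Proof.
have := ratio3 k m; set r := x k * _ => r3.
have [e|ne] := boolP (k == m %[mod 3]).
  have -> : r = 1; last by rewrite expr1n mulr1n; ring.
  by rewrite /r (_ : x k = x m) -?exprS ?x3 //; apply/eqP; rewrite (eq_prim_root_expr prim).
have : (r - 1) * (1 + r + r ^+ 2) = 0.
  by transitivity (r ^+ 3 - 1); [ring | rewrite r3 subrr].
move/eqP; rewrite mulf_eq0 subr_eq0 => /orP[/eqP r1|/eqP //].
case/negP: ne; rewrite -(eq_prim_root_expr prim) -/(x k) -/(x m); apply/eqP.
by transitivity (r * x m); [rewrite /r -mulrA -exprSr x3 mulr1 | rewrite r1 mul1r].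
Qed.

(** The Fourier matrix of [Z/3] multiplied on the right by [diag(1, q, q)]. *)
Definition fourier3 (q : F) : 'M[F]_3 :=
  \matrix_(k, j) [:: 1; q * x k; q * x k ^+ 2]`_j.

(** The inverses of cube roots of unity are written as squares, so this inverts [fourier3 q] when
    [q ^+ 3 = 1]. *)
Definition fourier3_inv (q : F) : 'M[F]_3 :=
  \matrix_(j, k) (3%:R^-1 * [:: 1; q ^+ 2 * x k ^+ 2; q ^+ 2 * x k]`_j).

Let fourier3_mul_inv p q k m :
  (fourier3 p *m fourier3_inv q) k m
  = 3%:R^-1 * (1 + (p * q ^+ 2) * ((x k * x m ^+ 2) + (x k * x m ^+ 2) ^+ 2)).
Proof.
rewrite mxE sum3 !mxE /=; transitivity (3%:R^-1 * (1 + p * q^+ 2 *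
  (x k * x m ^+ 2 + x k ^+ 2 * (x m ^+ 3 * x m)))); last by ring.
by rewrite x3 mul1r; ring.
Qed.

Lemma fourier3_invK q : q ^+ 3 = 1 -> fourier3 q *m fourier3_inv q = 1%:M.
Proof.
move=> q3; apply/matrixP=> k m; rewrite fourier3_mul_inv -exprS q3 mul1r addrA ratio mxE.
have -> : (k == m %[mod 3]) = (k == m) by rewrite !modn_small.
by case: eqP; rewrite ?mulVf ?mulr0.
Qed.

Lemma fourier3_unit q : q ^+ 3 = 1 -> fourier3 q \in unitmx.
Proof. by move/fourier3_invK/mulmx1_unit/proj1. Qed.

Lemma invmx_fourier3 q : q ^+ 3 = 1 -> invmx (fourier3 q) = fourier3_inv q.
Proof.
move=> q3; rewrite -[RHS](mulKmx (fourier3_unit q3)) fourier3_invK // mulmx1.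
by [].
Qed.

Lemma fourier3_unbiased_std q k m : q ^+ 3 = 1 ->
  fourier3 q k m * fourier3_inv q m k = 3%:R^-1.
Proof.
move=> q3; rewrite !mxE; move: m; apply: ord3P => /=.
- by rewrite mulr1 mul1r.
- by transitivity (3%:R^-1 * (q ^+ 3 * x k ^+ 3)); [ring | rewrite q3 x3 !mulr1].
- by transitivity (3%:R^-1 * (q ^+ 3 * x k ^+ 3)); [ring | rewrite q3 x3 !mulr1].
Qed.

(** With [s = w^(i - j)] and [r = w^(k - m)], nine times the product is
    [(1 + s (r + r^2)) (1 + s^2 (r + r^2))]. Here [s + s^2 = -1], and [r + r^2] is 2 or -1; the
    value is 3 in both cases. *)
Lemma fourier3_unbiased (i j : nat) k m : i != j %[mod 3] ->
  (fourier3 (x i) *m fourier3_inv (x j)) k m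
    * (fourier3 (x j) *m fourier3_inv (x i)) m k = 3%:R^-1.
Proof.
move=> ij; rewrite !fourier3_mul_inv.
have inv a b : x b * x a ^+ 2 = (x a * x b ^+ 2) ^+ 2.
  transitivity (x b ^+ 3 * x b * x a ^+ 2); [by rewrite x3 mul1r | by ring].
rewrite (inv i j) (inv k m).
have := ratio i j; rewrite (negPf ij) mulr0n; set s := x i * _ => s0.
have := ratio3 k m; have := ratio k m; set r := x k * _ => rE r3.
have r4 : r ^+ 2 ^+ 2 = r by rewrite -exprM (exprD r 3 1) r3 mul1r.
rewrite r4; have sE : s ^+ 2 = - 1 - s.
  by rewrite -[LHS]addr0 -[0]oppr0 -s0; ring.
have rr : r + r ^+ 2 = 3%:R *+ (k == m %[mod 3]) - 1 by rewrite -rE; ring.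
rewrite [r ^+ 2 + r]addrC rr sE; case: (k == m %[mod 3]); rewrite ?mulr1n ?mulr0n.
  transitivity (3%:R^-1 ^+ 2 * (3%:R - 4%:R * (1 + s + s ^+ 2))); first by ring.
  by rewrite s0; field.
transitivity (3%:R^-1 ^+ 2 * (3%:R - (1 + s + s ^+ 2))); first by ring.
by rewrite s0; field.
Qed.
End CubeRoot.

Lemma cube_root_has_COD3 (F : fieldType) (l : nat) (w : F) :
  (3 < l)%N -> 2%:R != 0 :> F -> 3%:R != 0 :> F -> 3.-primitive_root w -> has_COD F 3 l.
Proof.
move=> l3 n2 n3 prim; have w3 (k : nat) : (w ^+ k) ^+ 3 = 1.
  by rewrite -exprM mulnC exprM (prim_expr_order prim) expr1n.
(* Index 0 is the standard frame; the indices 1, 2, 3 give [q = w], [w^2] and [w^3 = 1], and they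
   are pairwise incongruent modulo 3. *)
pose Q (i : 'I_4) := if i == 0 then 1%:M else fourier3 w (w ^+ i).
have uQ i : Q i \in unitmx.
  by rewrite /Q; case: eqP => _; rewrite ?unitmx1 ?fourier3_unit.
have inv1 : invmx (1%:M : 'M[F]_3) = 1%:M by apply: invmx1.
apply: (@has_COD_of_orthogonal_frames _ _ _ Q) => // i j u v ij.
apply: (@unbiased_frames_orthogonal _ _ _ _ 3%:R^-1) => k m; rewrite /Q.
have [i0|i0] := eqVneq i 0; have [j0|j0] := eqVneq j 0.
- by rewrite i0 j0 eqxx in ij.
- rewrite inv1 invmx_fourier3 // mul1mx mulmx1 mulrC; exact: fourier3_unbiased_std.
- rewrite inv1 invmx_fourier3 // mul1mx mulmx1; exact: fourier3_unbiased_std.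
rewrite !invmx_fourier3 //; apply: fourier3_unbiased => //.
by move: i j ij i0 j0 => [[|[|[|[|//]]]] ?] [[|[|[|[|//]]]] ?].
Qed.

Theorem theorem3p5 (F : fieldType) (p : nat) :
  prime p -> (3 < p)%N -> p \in [pchar F] ->
  (has_COD F 3 p <-> exists z : F, 3.-primitive_root z).
Proof.
move=> pp p3 pF; have n0 k : (0 < k < 4)%N -> k%:R != 0 :> F.
  case/andP=> k0 k4; rewrite -(dvdn_pcharf pF); apply/negP => /(dvdn_leq k0).
  by rewrite leqNgt (leq_trans k4 p3).
split; first by apply: has_COD3_cube_root; apply: n0.
by case=> z; apply: cube_root_has_COD3 => //; apply: n0.
Qed.
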